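(* Let a decision circuit for an influence diagram be evaluated at evidence $\mathbf{e}'=\mathbf{e}\cup\{U=1\}$ with $P(\mathbf{e})>0$, yielding an optimal strategy $s^*$ at the reference values of the meta-parameters $\tau_1,\dots,\tau_K$, and for each $k$ let $I_k^T$ and $I_k^W$ be the intervals returned by the Admissible Interval Algorithm (described in the context). Let $\tau_k$ vary in $[0,1]$ with all other meta-parameters kept at their reference values. If $\tau_k\in I_k^T$, then $s^*$ stays optimal; and if $\tau_k\notin I_k^W$, then $s^*$ is no longer optimal.
   Context: **Influence diagram.** A directed acyclic graph of finitely many finite-valued variables: decision variables, uncertain variables with conditional probability tables $P(x\mid\mathbf{pa}(X))$, and a single binary utility variable $U$ without children, with values $1$ and $0$. Decisions are totally ordered, and no-forgetting holds (each decision's parents include all earlier decisions and their parents). A strategy $s$ chooses an available alternative for each decision in each scenario of its parents; it induces a joint distribution $P_s$. Evidence $\mathbf{e}$ is an observed instantiation of uncertain variables $\mathbf{E}$ (not including $U$) that are not affected by any decision, so $P_s(\mathbf{e})=P(\mathbf{e})$ for all $s$. A strategy is optimal if it maximizes $P_s(U=1\mid\mathbf{e})$ over all $s$. **Decision circuit.** For each value $x$ of each variable there is an evidence indicator $\lambda_x$, and for each instantiation of a variable $X$ (decisions included) and its parents a network parameter $\theta_{x|\mathbf{pa}(X)}$. For uncertain variables and $U$, $\theta_{x|\mathbf{pa}(X)}=P(x\mid\mathbf{pa}(X))$; for decisions, $\theta_{d|\mathbf{pa}(D)}$ is initially $1$ if the alternative is available in that scenario and $0$ otherwise. The decision circuit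 is a rooted directed acyclic graph whose leaves are constants or the variables $\lambda,\theta$ (and the meta-parameters), and whose other nodes are sums, products and maximizations (max nodes). It represents the dynamic programming recursion of the diagram: variables are eliminated in reverse order of observation, uncertain variables by summation and decisions by maximization over alternatives. When the max nodes are replaced by sum nodes it computes the polynomial $\sum_{\mathbf{z}}\prod_{x,\mathbf{pa}(X)\sim\mathbf{z}}\lambda_x\theta_{x|\mathbf{pa}(X)}$, the sum being over instantiations $\mathbf{z}$ of all variables and the product over all variables, with values consistent with $\mathbf{z}$. Evaluating at evidence $\mathbf{e}'$ means setting $\lambda_x=0$ if $\mathbf{e}'$ assigns $X$ another value and $\lambda_x=1$ otherwise, and evaluating upward from the leaves. Each max node corresponds to a decision in a scenario of relevant observed information, and has one child for each alternative $d$, that child containing the factor $\lambda_d\theta_{d|\cdot}$. In the upward sweep, the alternative with the highest value is selected at each max node (ties broken arbitrarily) and the decision parameters of all other alternatives are then set to $0$; the selected alternatives form $s^*$. Derivatives are then computed in a downward sweep with max nodes treated as sum nodes. A max node is inactive if the derivative of the root with respect to it, from this initial downward sweep (reference values, strategy $s^*$), equals $0$; otherwise it is active. **Meta-parameters.** There are meta-parameters $\tau_1,\dots,\tau_K\in[0,1]$, each associated with only one variable, whose network parameters $\theta_{x|\mathbf{pa}(X)}$ are linear (affine) functions of it, with reference values $\tau_k^0$. **Admissible Interval Algorithm.** For a max node $v$ and an available alternative $a$ at $v$, let $h_{v,a}(\tau_k)$ be the value of $v$ at evidence $\mathbf{e}'$ when alternative $a$ is chosen at $v$ and the choices of $s^*$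 are fixed at all max nodes below $v$, as a function of $\tau_k$ with the other meta-parameters at reference values. This is an affine function of $\tau_k$, found from its reference value and slope via partial derivatives in the subcircuit rooted at $v$. Let $a^*$ be the alternative selected by $s^*$ at $v$, and let $J_k(v)=\{\tau_k\in[0,1]: h_{v,a^*}(\tau_k)\ge h_{v,a}(\tau_k)\text{ for all available }a\}$, an interval containing $\tau_k^0$. The algorithm, for all $k$ simultaneously: initializes $I_k^T=I_k^W=[0,1]$; replaces $I_k^W$ by $I_k^W\cap J_k(v)$ for each active max node $v$; replaces $I_k^T$ by $I_k^T\cap J_k(v)$ for each inactive max node $v$; and finally resets $I_k^T$ to $I_k^T\cap I_k^W$. Thus it returns $I_k^W=[0,1]\cap\bigcap_{v\text{ active}}J_k(v)$ and $I_k^T=[0,1]\cap\bigcap_{v}J_k(v)$ over all max nodes $v$. *)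

(* Defs.v *)
From mathcomp Require Import all_boot all_order all_algebra.
Set Implicit Arguments.
Unset Strict Implicit.
Unset Printing Implicit Defensive.
Import Order.TTheory GRing.Theory Num.Theory.
Local Open Scope ring_scope.

Definition acyclic (T : finType) (e : rel T) : Prop :=
  forall x y, e x y -> ~~ connect e y x.

(* Instantiations of a set A of variables. *)
Definition inst (V : finType) (dom : V -> finType) (A : {set V}) : Type :=
  {dffun forall X : {X : V | X \in A}, dom (val X)}.

Definition restr (V : finType) (dom : V -> finType) (A : {set V})
    (z : {dffun forall X : V, dom X}) : inst dom A :=
  [ffun X : {X : V | X \in A} => z (val X)].
Arguments restr {V dom} A z.

Definition subinst (V : finType) (dom : V -> finType) (A B : {set V})
    (sAB : A \subset B) (w : inst dom B) : inst dom A :=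
  [ffun X : {X : V | X \in A} =>
     w (exist _ (val X) (subsetP sAB (val X) (valP X)))].

(* The decisions are 'I_ndec, in chronological order; [chance] collects the   *)
(* uncertain variables together with the utility variable.  [pa X] is the set *)
(* of parents of X, and [avail D w] the set of alternatives of D available in *)
(* the scenario w of its parents.                                             *)
Record diagram := Diagram {
  chance : finType;
  ndec : nat;
  dom : (chance + 'I_ndec)%type -> finType;
  pa : (chance + 'I_ndec)%type -> {set (chance + 'I_ndec)%type};
  avail : forall D : 'I_ndec, inst dom (pa (inr D)) -> {set dom (inr D)};
  util : chance;
  util1 : dom (inl util);
  util0 : dom (inl util);
  pa_acyclic : acyclic (fun X Y => X \in pa Y);
  no_forgetting : forall D D' : 'I_ndec, (D < D')%N ->
    inr D \in pa (inr D') /\ pa (inr D) \subset pa (inr D');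
  avail_neq0 : forall D w, @avail D w != set0;
  util_childless : forall X, inl util \notin pa X;
  util_neq : util1 != util0;
  util_binary : forall u, u = util1 \/ u = util0
}.

Notation var I := (chance I + 'I_(ndec I))%type.
Notation asgn I := {dffun forall X : var I, dom X}.

Definition arc (I : diagram) : rel (var I) := fun X Y => X \in pa Y.

Definition box (R : realFieldType) (K : nat) (tau : {ffun 'I_K -> R}) : Prop :=
  forall k, 0 <= tau k <= 1.

Definition upd (R : realFieldType) (K : nat) (tau : {ffun 'I_K -> R})
    (k : 'I_K) (t : R) : {ffun 'I_K -> R} :=
  [ffun j => if j == k then t else tau j].

(* [theta tau X x w] is P(x | w) when the meta-parameters have the values tau.*)
(* A variable may own several meta-parameters; its network parameters are     *)
(* affine in each of them separately.                                         *)
Record metaparam (I : diagram) (R : realFieldType) (K : nat) := Metaparam {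
  theta : {ffun 'I_K -> R} ->
    forall X : chance I, dom (inl X) -> inst (@dom I) (pa (inl X)) -> R;
  owner : 'I_K -> chance I;
  theta_ge0 : forall tau, box tau -> forall X x w, 0 <= @theta tau X x w;
  theta_sum1 : forall tau, box tau ->
    forall X w, \sum_(x : dom (inl X)) @theta tau X x w = 1;
  theta_affine : forall tau, box tau -> forall k X x w, owner k = X ->
    exists a b : R, forall t, 0 <= t <= 1 ->
      @theta (upd tau k t) X x w = a + b * t;
  theta_other : forall tau, box tau -> forall k X x w, owner k != X ->
    forall t, 0 <= t <= 1 -> @theta (upd tau k t) X x w = @theta tau X x w
}.

Definition strategy (I : diagram) : Type :=
  forall D : 'I_(ndec I), inst (@dom I) (pa (inr D)) -> dom (inr D).

Definition admissible (I : diagram) (s : strategy I) : Prop :=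
  forall D w, s D w \in avail w.

(* Observed values; None where nothing is observed. *)
Definition observation (I : diagram) : Type :=
  forall X : chance I, option (dom (inl X)).

Definition is_evidence (I : diagram) (e : observation I) : Prop :=
  e (util I) = None /\
  forall X, e X <> None -> forall D, ~~ connect (@arc I) (inr D) (inl X).

Definition with_util1 (I : diagram) (e : observation I) : observation I :=
  dfwith e (Some (util1 I)).

Definition agree (I : diagram) (e : observation I) (z : asgn I) : bool :=
  [forall X, if e X is Some x then z (inl X) == x else true].

Section Probability.
Context {I : diagram} {R : realFieldType} {K : nat} (P : metaparam I R K).
Implicit Types (tau : {ffun 'I_K -> R}) (s : strategy I) (e : observation I).

Definition joint tau s (z : asgn I) : R :=
  (\prod_(X : chance I) theta P tau (z (inl X)) (restr (pa (inl X)) z)) *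
  (\prod_(D : 'I_(ndec I)) (z (inr D) == s D (restr (pa (inr D)) z))%:R).

Definition prob tau s e : R := \sum_(z : asgn I | agree e z) joint tau s z.

(* P_s(U = 1 | e).  If P(e) = 0 the quotient is 0 for every s. *)
Definition prob_util1 tau s e : R :=
  prob tau s (with_util1 e) / prob tau s e.

Definition optimal tau e s : Prop :=
  admissible s /\
  forall s', admissible s' -> prob_util1 tau s' e <= prob_util1 tau s e.

End Probability.

(* The part [relpa D] of the information available at D on which the max nodes  *)
(* of a circuit branch; it has to determine the available alternatives.  No   *)
(* reduction is made when relpa D = pa (inr D).                                 *)
Record relevance (I : diagram) := Relevance {
  relpa : 'I_(ndec I) -> {set var I};
  relpaS : forall D, relpa D \subset pa (inr D);
  ravail : forall D : 'I_(ndec I), inst (@dom I) (relpa D) -> {set dom (inr D)};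
  ravailE : forall D (w : inst (@dom I) (pa (inr D))),
    ravail (subinst (relpaS D) w) = avail w
}.

Notation scen V D := (inst (@dom _) (relpa V D)).

(* [Theta] leaves carry the network parameters of uncertain variables and of  *)
(* U (an affine function of the meta-parameters), [DTheta] leaves those of    *)
(* decisions.  A max node bears its decision and its scenario, and has one    *)
(* child for each alternative.                                                *)
Inductive gate (I : diagram) (R : realFieldType) (V : relevance I)
    (node : finType) : Type :=
  | Const of R
  | Lambda (X : var I) of dom X
  | Theta (X : chance I) of dom (inl X) & inst (@dom I) (pa (inl X))
  | DTheta (D : 'I_(ndec I)) of dom (inr D) & scen V D
  | Sum of seq node
  | Prod of seq node
  | Max (D : 'I_(ndec I)) of scen V D & (dom (inr D) -> node).
Arguments Const {I R V node}.
Arguments Lambda {I R V node} X.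
Arguments Theta {I R V node} X.
Arguments DTheta {I R V node} D.
Arguments Sum {I R V node}.
Arguments Prod {I R V node}.
Arguments Max {I R V node} D.

Definition children (I : diagram) (R : realFieldType) (V : relevance I)
    (node : finType) (g : gate R V node) : seq node :=
  match g with
  | Sum c | Prod c => c
  | Max D _ c => [seq c d | d : dom (inr D)]
  | _ => [::]
  end.

Record circuit (I : diagram) (R : realFieldType) (V : relevance I) := Circuit {
  node : finType;
  root : node;
  gt : node -> gate R V node;
  circuit_acyclic : acyclic (fun v w => w \in children (gt v));
  circuit_rooted : forall w, w != root <-> exists v, w \in children (gt v)
}.

Section Evaluation.
Context {I : diagram} {R : realFieldType} {V : relevance I}.

Record valuation := Valuation {
  vlam : forall X : var I, dom X -> R;
  vth : forall X : chance I, dom (inl X) -> inst (@dom I) (pa (inl X)) -> R;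
  vdth : forall D : 'I_(ndec I), dom (inr D) -> scen V D -> R
}.

Definition valuation_ge0 (p : valuation) : Prop :=
  [/\ forall X x, 0 <= @vlam p X x, forall X x w, 0 <= @vth p X x w
    & forall D d r, 0 <= @vdth p D d r].

Variable C : circuit R V.

(* Upward sweep, max nodes being read as maximizations if [mx] and as sums    *)
(* otherwise.  The recursion depth n never exceeds the number of nodes, by    *)
(* acyclicity.  0 is a harmless bottom element for the maximum because the    *)
(* circuits of interest only take non-negative values under a maximization.   *)
Fixpoint eval_rec (mx : bool) (p : valuation) (n : nat) (v : node C) : R :=
  if n is n'.+1 then
    match gt v with
    | Const a => a
    | Lambda X x => vlam p x
    | Theta X x w => vth p x w
    | DTheta D d r => vdth p d r
    | Sum c => \sum_(w <- c) eval_rec mx p n' w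
    | Prod c => \prod_(w <- c) eval_rec mx p n' w
    | Max D _ c =>
        if mx then \big[Num.max/0]_(d : dom (inr D)) eval_rec mx p n' (c d)
        else \sum_(d : dom (inr D)) eval_rec mx p n' (c d)
    end
  else 0.

Definition eval_max (p : valuation) : node C -> R := eval_rec true p #|node C|.
Definition eval_sum (p : valuation) : node C -> R := eval_rec false p #|node C|.

(* Partial derivative of the node v with respect to its child w, max nodes    *)
(* being read as sums.                                                        *)
Definition local_deriv (p : valuation) (v w : node C) : R :=
  match gt v with
  | Sum c => (count_mem w c)%:R
  | Prod c => \sum_(i < size c | nth w c i == w)
                \prod_(j < size c | j != i) eval_sum p (nth w c j)
  | Max D _ c => #|[set d : dom (inr D) | c d == w]|%:R
  | _ => 0
  end.

(* Downward sweep: derivative of the root with respect to w. *)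
Fixpoint deriv_rec (p : valuation) (n : nat) (w : node C) : R :=
  if n is n'.+1 then
    (w == root C)%:R + \sum_(v : node C) deriv_rec p n' v * local_deriv p v w
  else 0.

Definition deriv_root (p : valuation) : node C -> R := deriv_rec p #|node C|.

Definition network_term (p : valuation) (z : asgn I) : R :=
  (\prod_(X : var I) vlam p (z X)) *
  (\prod_(X : chance I) vth p (z (inl X)) (restr (pa (inl X)) z)) *
  (\prod_(D : 'I_(ndec I)) vdth p (z (inr D)) (restr (relpa V D) z)).

(* Orders of observation: the parents of a decision come before it, all the   *)
(* other variables after it.                                                  *)
Definition observation_order (ord : seq (var I)) : Prop :=
  [/\ uniq ord, forall X, X \in ord
    & forall D X, X != inr D ->
        (X \in pa (inr D)) = (index X ord < index (inr D) ord)%N].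

Definition set_var (z : asgn I) (X : var I) (x : dom X) : asgn I :=
  [ffun Y => dfwith z x Y].

(* Dynamic programming: the variables of [ord] are eliminated from the last   *)
(* to the first.  If [ord] contains all the variables, the result does not    *)
(* depend on z.                                                               *)
Fixpoint dp (p : valuation) (ord : seq (var I)) (z : asgn I) : R :=
  match ord with
  | [::] => network_term p z
  | inl X :: ord' => \sum_(x : dom (inl X)) dp p ord' (set_var z x)
  | inr D :: ord' =>
      \big[Num.max/0]_(d : dom (inr D)) dp p ord' (set_var z d)
  end.

Record is_decision_circuit : Prop := IsDecisionCircuit {
  const_ge0 : forall (v : node C) a, gt v = Const a -> 0 <= a;
  max_uniq : forall (v v' : node C) D (r : scen V D) c c',
    gt v = Max D r c ->
    gt v' = Max D r c' -> v = v';
  max_inj : forall (v : node C) D (r : scen V D) c,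
    gt v = Max D r c -> injective c;
  max_factor : forall (v : node C) D (r : scen V D) c,
    gt v = Max D r c -> forall d, exists s,
      [/\ gt (c d) = Prod s,
          exists2 l, l \in s & gt l = Lambda (inr D) d
        & exists2 l, l \in s & gt l = DTheta D d r];
  (* theta_{d|r} is used only in the child for d of the max node for (D, r),  *)
  (* and that child only in the max node                                      *)
  dtheta_parent : forall (l u : node C) D d (r : scen V D),
    gt l = DTheta D d r -> l \in children (gt u) ->
    exists v c, gt v = Max D r c /\ u = c d;
  alt_parent : forall (v : node C) D (r : scen V D) c d u,
    gt v = Max D r c -> c d \in children (gt u) -> u = v;
  sum_polynomial : forall p, eval_sum p (root C) = \sum_z network_term p z;
  max_dp : exists2 ord, observation_order ord &
    forall p, valuation_ge0 p -> forall z, eval_max p (root C) = dp p ord z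
}.

End Evaluation.

Section Algorithm.
Context {I : diagram} {R : realFieldType} {V : relevance I} {K : nat}.
Variables (P : metaparam I R K) (C : circuit R V) (tau0 : {ffun 'I_K -> R}).
Variable e : observation I.

(* An alternative for each decision and scenario of relevant information. *)
Definition selection : Type :=
  forall D : 'I_(ndec I), scen V D -> dom (inr D).

Definition strategy_of (sel : selection) : strategy I :=
  fun D w => sel D (subinst (relpaS V D) w).

Definition indicator (e' : observation I) (X : var I) : dom X -> R :=
  match X with
  | inl Y => fun x => if e' Y is Some y then (x == y)%:R else 1
  | inr D => fun _ => 1
  end.

(* Evidence e and U = 1, meta-parameters tau; the decision parameters are     *)
(* the initial ones, or those of the alternatives selected by [sel].          *)
Definition val_init (tau : {ffun 'I_K -> R}) : valuation (R := R) (V := V) :=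
  Valuation (@indicator (with_util1 e)) (@theta I R K P tau)
    (fun D d r => (d \in ravail r)%:R).

Definition val_sel (tau : {ffun 'I_K -> R}) (sel : selection) :
    valuation (R := R) (V := V) :=
  Valuation (@indicator (with_util1 e)) (@theta I R K P tau)
    (fun D d r => (d == sel D r)%:R).

(* [sel] may result from the upward sweep at the reference values.  An        *)
(* unavailable alternative, of value 0, is never selected, not even when it   *)
(* ties with the available ones.                                              *)
Definition selected (sel : selection) : Prop :=
  (forall D r, sel D r \in ravail r) /\
  (forall (v : node C) D (r : scen V D) c, gt v = Max D r c ->
     forall d, eval_max (val_init tau0) (c d)
                 <= eval_max (val_init tau0) (c (sel D r))).

Variable sel : selection.

Definition active (v : node C) : bool :=
  deriv_root (val_sel tau0 sel) v != 0.

Definition sel_with (D : 'I_(ndec I)) (r : scen V D) (a : dom (inr D)) :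
    selection :=
  dfwith sel (fun r' : scen V D => if r' == r then a else sel r').

Definition hval (k : 'I_K) (v : node C) (D : 'I_(ndec I)) (r : scen V D)
    (a : dom (inr D)) (t : R) : R :=
  eval_sum (val_sel (upd tau0 k t) (sel_with r a)) v.

(* Only meaningful when v is a max node. *)
Definition Jint (k : 'I_K) (v : node C) (t : R) : bool :=
  (0 <= t <= 1) &&
  match gt v with
  | Max D r _ => [forall a in ravail r, hval k v r a t <= hval k v r (sel r) t]
  | _ => true
  end.

Definition is_max (v : node C) : bool :=
  if gt v is Max _ _ _ then true else false.

Definition interval_W (k : 'I_K) (t : R) : bool :=
  (0 <= t <= 1) && [forall v, is_max v && active v ==> Jint k v t].

Definition interval_T (k : 'I_K) (t : R) : bool :=
  [&& 0 <= t <= 1, [forall v, is_max v && ~~ active v ==> Jint k v t]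
    & interval_W k t].

End Algorithm.

(* Main.v *)
(** Let s* be locally optimal at every max node for the value t of tau_k.  By
    induction from the leaves, the maximizing sweep then agrees with the summing
    sweep restricted to s*, so P(e, U = 1) under s* equals the value of the
    dynamic program, which dominates every strategy; P(e) does not depend on the
    strategy since decisions do not affect the evidence.

    Conversely, let some alternative a beat s* at an active max node v for the
    value t, and let X be the owner of tau_k.  By optimality of s* at the
    reference values, v depends on the parameters of X.  No cancellation occurs
    in the circuit and its polynomial is linear in the parameters of X, so on a
    path from the root to v along non-zero local derivatives, the factors
    multiplied with v are free of X: they remain positive when tau_k varies.
    Hence the improvement at v propagates to the root, strictly. *)
Require Import Defs.
From mathcomp Require Import all_boot all_order all_algebra.
From mathcomp Require Import ring.
Set Implicit Arguments.
Unset Strict Implicit.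
Unset Printing Implicit Defensive.
Import Order.TTheory GRing.Theory Num.Theory.
Local Open Scope ring_scope.

(** * Ranks in acyclic graphs, and big operators over sequences *)

(** The number of reachable vertices is a rank for inductions on the circuit and on the network: it
    drops because the source of an edge cannot be reached back. *)
Lemma acyclic_card_connect (T : finType) (e : rel T) x y :
  acyclic e -> e x y -> (#|connect e y| < #|connect e x|)%N.
Proof.
move=> ace exy; apply/proper_card/properP; split.
  by apply/subsetP => z; rewrite !inE; apply: connect_trans (connect1 exy).
by exists x; rewrite !inE ?connect0 //; apply: ace.
Qed.

Lemma prod_nth (R : comNzRingType) (T : Type) (x0 : T) (c : seq T)
    (i : 'I_(size c)) (F : T -> R) :
  \prod_(x <- c) F x =
    F (nth x0 c i) * \prod_(j < size c | j != i) F (nth x0 c j).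
Proof. by rewrite (big_nth x0) big_mkord (bigD1 i). Qed.

Lemma ler_big_seq_prod (R : numDomainType) (T : eqType) (c : seq T) (F G : T -> R) :
  {in c, forall x, 0 <= F x <= G x} -> \prod_(x <- c) F x <= \prod_(x <- c) G x.
Proof.
by move=> FG; rewrite big_seq [leRHS]big_seq; apply: ler_prod => x; apply: FG.
Qed.

Lemma ler_big_seq_sum (R : numDomainType) (T : eqType) (c : seq T) (F G : T -> R) :
  {in c, forall x, F x <= G x} -> \sum_(x <- c) F x <= \sum_(x <- c) G x.
Proof.
by move=> FG; rewrite big_seq [leRHS]big_seq; apply: ler_sum => x; apply: FG.
Qed.

(** * Circuit evaluation *)

Section Circuit.
Context {I : diagram} {R : realFieldType} {V : relevance I} (C : circuit R V).
Implicit Types (p : valuation (I := I) (R := R) (V := V)) (u v w : node C).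

Definition wire : rel (node C) := fun v w => w \in children (gt v).

Lemma rank_child v w :
  w \in children (gt v) -> (#|connect wire w| < #|connect wire v|)%N.
Proof. exact: (acyclic_card_connect (@circuit_acyclic _ _ _ C)). Qed.

(** The hypothesis covers all proper descendants, not only children: a max node is later treated
    together with its alternatives, two levels at a time. *)
Lemma circuit_ind (Q : node C -> Prop) :
  (forall v, (forall w, connect wire v w -> w != v -> Q w) -> Q v) ->
  forall v, Q v.
Proof.
move=> step v; have [n] := ubnP #|connect wire v|.
elim: n v => // n IHn v; rewrite ltnS => le_n; apply: step => w.
case/connectP => -[|u s] /= => [_ -> | /andP[vu us] def_w _]; first by rewrite eqxx.
apply: IHn; apply: leq_trans le_n; apply: leq_ltn_trans (rank_child vu).
apply/subset_leq_card/subsetP => z; rewrite !inE; apply: connect_trans.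
by apply/connectP; exists s.
Qed.

Lemma child_connect v w : w \in children (gt v) -> connect wire v w.
Proof. by move=> ?; apply: connect1. Qed.

Lemma child_acyclic v w : w \in children (gt v) -> ~~ connect wire w v.
Proof. exact: (@circuit_acyclic _ _ _ C). Qed.

Lemma child_neq v w : w \in children (gt v) -> w != v.
Proof. by move=> /child_acyclic; apply: contraNneq => ->; apply: connect0. Qed.

(** One step of the sweep, free of the recursion depth. A max node read as a sum ranges over its
    list of children, like a sum gate. *)
Definition gate_eval (mx : bool) p (g : gate R V (node C)) (f : node C -> R) : R :=
  match g with
  | Const a => a
  | Lambda X x => vlam p x
  | Theta X x w => vth p x w
  | DTheta D d r => vdth p d r
  | Sum c => \sum_(w <- c) f w
  | Prod c => \prod_(w <- c) f w
  | Max D _ c =>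
      if mx then \big[Num.max/0]_(d : dom (inr D)) f (c d)
      else \sum_(w <- [seq c d | d : dom (inr D)]) f w
  end.

Lemma eq_gate_eval mx p g f f' :
  {in children g, f =1 f'} -> gate_eval mx p g f = gate_eval mx p g f'.
Proof.
case: g => //= [c|c|D r c] ff'; try exact: eq_big_seq.
case: mx; last exact: eq_big_seq.
by apply: eq_bigr => d _; apply: ff'; apply: image_f.
Qed.

Lemma eval_rec_fuel mx p v m n :
  (#|connect wire v| <= m)%N -> (#|connect wire v| <= n)%N ->
  eval_rec mx p m v = eval_rec mx p n v.
Proof.
have unfold k u : eval_rec mx p k.+1 u = gate_eval mx p (gt u) (eval_rec mx p k).
  by rewrite /=; case: (gt u) => //= D r c; case: mx => //; rewrite big_image.
have pos u : (0 < #|connect wire u|)%N by apply/card_gt0P; exists u; apply: connect0.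
elim: m v n => [|m IHm] v [|n]; do 1?[by rewrite leqNgt pos].
  by move=> _; rewrite leqNgt pos.
move=> le_m le_n; rewrite !unfold; apply: eq_gate_eval => w /rank_child lt_wv.
by apply: IHm; rewrite -ltnS; [apply: leq_trans le_m | apply: leq_trans le_n].
Qed.

Lemma eval_recE mx p v :
  eval_rec mx p #|node C| v = gate_eval mx p (gt v) (eval_rec mx p #|node C|).
Proof.
rewrite (@eval_rec_fuel mx p v _ #|node C|.+1) ?leqW ?max_card //=.
by case: (gt v) => //= D r c; case: mx => //; rewrite big_image.
Qed.

Lemma eval_sumE p v : eval_sum p v = gate_eval false p (gt v) (eval_sum p).
Proof. exact: eval_recE. Qed.

Lemma eval_maxE p v : eval_max p v = gate_eval true p (gt v) (eval_max p).
Proof. exact: eval_recE. Qed.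

Hypothesis hC : is_decision_circuit C.

Lemma eval_sum_ge0 p : valuation_ge0 p -> forall v, 0 <= eval_sum p v.
Proof.
case=> p1 p2 p3; elim/circuit_ind => v IHv; rewrite eval_sumE.
have IH w : w \in children (gt v) -> 0 <= eval_sum p w.
  by move=> wv; apply: IHv (child_connect wv) (child_neq wv).
move: IH; case E: (gt v) => [a|X x|X x w|D d r|c|c|D r c] //= IH.
- exact: const_ge0 E.
- by rewrite big_seq sumr_ge0.
- by rewrite big_seq prodr_ge0.
- by rewrite big_seq sumr_ge0.
Qed.

Lemma eval_max_ge0 p : valuation_ge0 p -> forall v, 0 <= eval_max p v.
Proof.
case=> p1 p2 p3; elim/circuit_ind => v IHv; rewrite eval_maxE.
have IH w : w \in children (gt v) -> 0 <= eval_max p w.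
  by move=> wv; apply: IHv (child_connect wv) (child_neq wv).
move: IH; case E: (gt v) => [a|X x|X x w|D d r|c|c|D r c] //= IH.
- exact: const_ge0 E.
- by rewrite big_seq sumr_ge0.
- by rewrite big_seq prodr_ge0.
- exact: bigmax_ge_id.
Qed.

Definition leaf_le p p' (g : gate R V (node C)) : Prop :=
  match g with
  | Lambda X x => vlam p x <= vlam p' x
  | Theta X x w => vth p x w <= vth p' x w
  | DTheta D d r => vdth p d r <= vdth p' d r
  | _ => True
  end.

(** Sums and products of non-negative values are monotone. The predicate [Q] marks the region
    explored; the descent may stop at a node where the inequality is already known. *)
Lemma eval_sum_mono p p' (Q : node C -> Prop) :
  valuation_ge0 p ->
  (forall v, Q v -> eval_sum p v <= eval_sum p' v \/
     leaf_le p p' (gt v) /\ {in children (gt v), forall w, Q w}) ->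
  forall v, Q v -> eval_sum p v <= eval_sum p' v.
Proof.
move=> p0 step; elim/circuit_ind => v IHv /step[//|[lf ch]].
have IH w : w \in children (gt v) -> eval_sum p w <= eval_sum p' w.
  by move=> wv; apply: IHv (child_connect wv) (child_neq wv) (ch _ wv).
rewrite !eval_sumE.
move: IH lf; case: (gt v) => [a|X x|X x w|D d r|c|c|D r c] //= IH _.
- exact: ler_big_seq_sum.
- by apply: ler_big_seq_prod => w /IH; rewrite eval_sum_ge0.
- exact: ler_big_seq_sum.
Qed.

(* [scaled X c] makes the value of a node a polynomial in c whose exponents are
   the degrees of the node in the parameters of X; no cancellation can occur. *)
Definition scaled (X : chance I) (c : R) : valuation (I := I) (R := R) (V := V) :=
  Valuation (fun _ _ => 1) (fun Y _ _ => if Y == X then c else 1) (fun _ _ _ => 1).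

Lemma scaled_ge0 X c : 0 <= c -> valuation_ge0 (scaled X c).
Proof. by move=> c0; split=> [*|Y x w|*] /=; rewrite ?ler01 //; case: ifP. Qed.

Lemma eval_scaled_ge0 X c v : 1 <= c -> 0 <= eval_sum (scaled X c) v.
Proof. by move=> c1; apply: eval_sum_ge0; apply/scaled_ge0/(le_trans ler01). Qed.

Lemma eval_scaled_mono X c v :
  1 <= c -> eval_sum (scaled X 1) v <= eval_sum (scaled X c) v.
Proof.
move=> c1; apply: (@eval_sum_mono _ _ (fun=> True)) => //.
  exact: scaled_ge0 ler01.
move=> u _; right; split=> //.
by case: (gt u) => //= Y x w; case: ifP.
Qed.

(** No leaf other than a constant vanishes under [scaled X 1], so the zero comes from zero constants
    or empty sums, whatever the valuation. *)
Lemma eval_scaled_eq0 X v :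
  eval_sum (scaled X 1) v = 0 -> forall p, eval_sum p v = 0.
Proof.
move=> + p; elim/circuit_ind: v => v IHv; rewrite !eval_sumE.
have IH w : w \in children (gt v) -> eval_sum (scaled X 1) w == 0 -> eval_sum p w = 0.
  by move=> wv /eqP; apply: IHv (child_connect wv) (child_neq wv).
have ge0 w : 0 <= eval_sum (scaled X 1) w by apply: eval_scaled_ge0.
have sum0 c : {in c, forall w, eval_sum (scaled X 1) w == 0 -> eval_sum p w = 0} ->
    \sum_(w <- c) eval_sum (scaled X 1) w = 0 -> \sum_(w <- c) eval_sum p w = 0.
  move=> c0 /eqP; rewrite psumr_eq0 // => /allP all0.
  by rewrite big_seq big1 // => w wc; apply/c0/(all0 w).
move: IH; case: (gt v) => [a|Y x|Y x w|D d r|c|c|D r c] //= IH; try exact: sum0.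
- by move/eqP; rewrite oner_eq0.
- by move/eqP; rewrite if_same oner_eq0.
- by move/eqP; rewrite oner_eq0.
move/eqP; rewrite prodf_seq_eq0 => /hasP[w wc /= w0].
by apply/eqP; rewrite prodf_seq_eq0; apply/hasP; exists w; rewrite //= IH.
Qed.

Lemma eval_scaled_gt0 X p v : eval_sum p v != 0 -> 0 < eval_sum (scaled X 1) v.
Proof.
move=> pv; rewrite lt_def eval_scaled_ge0 // andbT.
by apply: contraNneq pv => /eval_scaled_eq0 ->.
Qed.

(** * Dependence on the parameters of one variable *)

Definition eq_off (X : chance I) p p' : Prop :=
  [/\ forall Y (x : dom Y), vlam p x = vlam p' x,
      forall Y (x : dom (inl Y)) y, Y != X -> vth p x y = vth p' x y
    & forall D (d : dom (inr D)) (r : scen V D), vdth p d r = vdth p' d r].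

Definition theta_free X v : Prop :=
  forall p p', eq_off X p p' -> eval_sum p v = eval_sum p' v.

(** As nothing cancels, growth at least linear in [c] detects a parameter of [X] in a non-zero
    term. *)
Definition grows X v : Prop :=
  exists2 m : R, 0 < m & forall c, 1 <= c -> m * c <= eval_sum (scaled X c) v.

(** Without cancellation, a growing child makes a sum grow. It makes a product grow as well, unless
    some factor vanishes identically; then the product is constantly zero, hence free of [X]. *)
Lemma theta_free_or_grows X v : theta_free X v \/ grows X v.
Proof.
elim/circuit_ind: v => v IHv.
have {}IHv w : w \in children (gt v) -> theta_free X w \/ grows X w.
  by move=> wv; apply: IHv (child_connect wv) (child_neq wv).
have split_seq (s : seq (node C)) : {in s, forall w, theta_free X w \/ grows X w} ->
    {in s, forall w, theta_free X w} \/ exists2 w, w \in s & grows X w.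
  elim: s => [|w s IHs] ws; first by left.
  case: (ws w (mem_head _ _)) => [fw|gw]; last by right; exists w; rewrite ?mem_head.
  case: IHs => [u us|fs|[u us gu]]; first by apply: ws; rewrite inE us orbT.
    by left=> u; rewrite inE => /predU1P[->|/fs].
  by right; exists u; rewrite // inE us orbT.
have add_case s :
    (forall p, eval_sum p v = \sum_(w <- s) eval_sum p w) ->
    {in s, forall w, theta_free X w \/ grows X w} -> theta_free X v \/ grows X v.
  move=> evE /split_seq[fs|[w ws [m m0 mP]]]; [left | right].
    by move=> p p' pp'; rewrite !evE; apply: eq_big_seq => w /fs; apply.
  exists m => // c c1; apply: le_trans (mP c c1) _.
  rewrite evE (big_rem w) //= lerDl sumr_ge0 // => u _.
  exact: eval_scaled_ge0.
move: IHv; case E: (gt v) => [a|Y x|Y x w|D d r|s|s|D r s] //= IHv;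
  do 1?[by left=> p p' [h1 h2 h3]; rewrite !eval_sumE E /=];
  do 1?[by apply: add_case IHv => p; rewrite eval_sumE E].
- have [YX|YX] := eqVneq Y X; [right | left].
    by exists 1 => // c _; rewrite mul1r eval_sumE E /= YX eqxx.
  by move=> p p' [h1 h2 h3]; rewrite !eval_sumE E /= h2.
- have [/hasP[w ws /eqP w0]|/hasPn s0] :=
    boolP (has (fun w => eval_sum (scaled X 1) w == 0) s).
    left=> p p' _; rewrite !eval_sumE E /=.
    have zero q : \prod_(u <- s) eval_sum q u = 0.
      by rewrite (big_rem w ws) /= (eval_scaled_eq0 w0) mul0r.
    by rewrite !zero.
  have {}s0 w : w \in s -> 0 < eval_sum (scaled X 1) w.
    by move/s0; apply: eval_scaled_gt0.
  case/split_seq: IHv => [fs|[w ws [m m0 mP]]]; [left | right].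
    by move=> p p' pp'; rewrite !eval_sumE E /=; apply: eq_big_seq => w /fs; apply.
  set k := \prod_(u <- rem w s) eval_sum (scaled X 1) u.
  exists (m * k) => [|c c1].
    by rewrite mulr_gt0 // /k big_seq prodr_gt0 // => u /mem_rem/s0.
  rewrite eval_sumE E /= (big_rem w) //= mulrAC.
  have k0 : 0 <= k by apply: prodr_ge0 => u _; apply: eval_scaled_ge0.
  apply: ler_pM => //; [by rewrite mulr_ge0 ?ltW // (lt_le_trans ltr01)|exact: mP|].
  by apply: ler_prod => u _; rewrite eval_scaled_ge0 //= eval_scaled_mono.
Qed.

(** Each term of the network polynomial contains exactly one parameter of [X]. *)
Lemma eval_root_scaled X c :
  eval_sum (scaled X c) (Defs.root C) = c * #|{: asgn I}|%:R.
Proof.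
rewrite (sum_polynomial hC) -sum1_card natr_sum mulr_sumr.
apply: eq_bigr => z _; rewrite /network_term /= !big1_eq mul1r mulr1 mulr1.
by rewrite -big_mkcond big_pred1_eq.
Qed.

(* A chain of non-zero local derivatives from the root. *)
Inductive live p : node C -> Prop :=
  | live_root : live p (Defs.root C)
  | live_child u w : live p u -> local_deriv p u w != 0 -> live p w.

Lemma deriv_live p w : deriv_root p w != 0 -> live p w.
Proof.
rewrite /deriv_root; elim: #|node C| w => [|n IHn] w /=; first by rewrite eqxx.
case: (eqVneq w (Defs.root C)) => [-> _|_]; first exact: live_root.
rewrite add0r => sum_n0.
have [/existsP[u]|/existsPn z]
    := boolP [exists u, deriv_rec p n u * local_deriv p u w != 0].
  by rewrite mulf_eq0 negb_or => /andP[/IHn]; apply: live_child.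
by case/eqP: sum_n0; apply: big1 => u _; apply/eqP; have:= z u; rewrite negbK.
Qed.

Lemma local_derivP p u w : local_deriv p u w != 0 ->
  (w \in children (gt u)) /\
  ((forall q, eval_sum q u = \sum_(x <- children (gt u)) eval_sum q x) \/
   exists c (i : 'I_(size c)),
     [/\ gt u = Prod c, nth w c i = w
       & \prod_(j < size c | j != i) eval_sum p (nth w c j) != 0]).
Proof.
rewrite /local_deriv; case E: (gt u) => [a|Y x|Y x y|D d r|s|s|D r s]; rewrite ?eqxx //=.
- rewrite pnatr_eq0 -lt0n -has_count => /hasP[x xs /eqP def_x].
  by split; [rewrite -def_x | left=> q; rewrite eval_sumE E].
- move=> n0.
  have [/existsP[i /andP[/eqP wi prod0]]|/existsPn z] := boolP [exists i : 'I_(size s),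
     (nth w s i == w) && (\prod_(j < size s | j != i) eval_sum p (nth w s j) != 0)].
    by split; [rewrite -wi mem_nth | right; exists s, i].
  case/eqP: n0; apply: big1 => i wi; apply/eqP.
  by have:= z i; rewrite wi negbK.
- rewrite pnatr_eq0 cards_eq0 => /set0Pn[d]; rewrite inE => /eqP dw.
  by split; [rewrite -dw; apply: image_f | left=> q; rewrite eval_sumE E].
Qed.

(** The linear bound at the root descends: a sum of non-negative terms bounds each of them, and for
    a product one divides by the other factors at [c = 1], positive because they are non-zero under
    [p]. *)
Lemma live_scaled_le X p w : live p w ->
  exists B : R, forall c, 1 <= c -> eval_sum (scaled X c) w <= B * c.
Proof.
elim=> [|u {}w _ [B BP] /local_derivP[wu]].
  by exists #|{: asgn I}|%:R => c _; rewrite eval_root_scaled mulrC.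
case=> [evE|[s [i [E wi prod0]]]].
  exists B => c c1; apply: le_trans (BP c c1); rewrite evE (big_rem w) //= lerDl.
  by apply: sumr_ge0 => x _; apply: eval_scaled_ge0.
set k := \prod_(j < size s | j != i) eval_sum (scaled X 1) (nth w s j).
have k0 : 0 < k.
  apply: prodr_gt0 => j ji; apply: (@eval_scaled_gt0 X p).
  by have /prodf_neq0/(_ j ji) := prod0.
exists (B / k) => c c1; rewrite mulrAC ler_pdivlMr //; apply: le_trans (BP c c1).
rewrite (eval_sumE _ u) E /= (prod_nth w i) wi ler_wpM2l ?eval_scaled_ge0 //.
by apply: ler_prod => j _; rewrite eval_scaled_ge0 //= eval_scaled_mono.
Qed.


Lemma quadratic_not_linear (k B : R) :
  0 < k -> ~ (forall c, 1 <= c -> k * c * c <= B * c).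
Proof.
(* For this [c], [k * c] equals [|B| + k], which exceeds [B]. *)
move=> k0 /(_ (`|B| / k + 1)).
have c1 : 1 <= `|B| / k + 1 by rewrite lerDr divr_ge0 ?normr_ge0 // ltW.
move/(_ c1); rewrite ler_pM2r ?(lt_le_trans ltr01) //.
rewrite mulrDr mulr1 mulrC divfK ?gt_eqF // => le_B.
by have := le_trans le_B (ler_norm B); rewrite gerDl leNgt k0.
Qed.

Lemma root_not_child u : Defs.root C \notin children (gt u).
Proof.
by apply/negP => ru; have [_] := @circuit_rooted _ _ _ C (Defs.root C);
   rewrite eqxx => /(_ (ex_intro _ u ru)).
Qed.

(** With decision parameters 1 and all other circuit variables 0, the network polynomial vanishes,
    by the indicator of the utility variable, while such a leaf has value 1. *)
Lemma root_not_dtheta D (d : dom (inr D)) (r : scen V D) :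
  gt (Defs.root C) <> DTheta D d r.
Proof.
move=> E; pose p := Valuation (R := R) (fun X (x : dom X) => 0)
  (fun X (x : dom (inl X)) _ => 0) (fun D (d : dom (inr D)) (r : scen V D) => 1).
have := sum_polynomial hC p; rewrite eval_sumE E /= big1 => [/eqP|z _].
  by rewrite oner_eq0.
by rewrite /network_term (bigD1 (inl (util I))) //= !mul0r.
Qed.

(** * Propagation of an improvement from a max node to the root *)

Section MaxNode.
Variables (v : node C) (D : 'I_(ndec I)) (r : scen V D) (c : dom (inr D) -> node C).
Hypothesis vE : gt v = Max D r c.

(** In a decision circuit, the decision parameters for [r] can be reached from such a node only
    through [v]. *)
Definition off_max w : Prop :=
  w \notin children (gt v) /\ forall d, gt w <> DTheta D d r.

Lemma off_max_child u w :
  off_max u -> u <> v -> w \in children (gt u) -> off_max w.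
Proof.
move=> [uv _] neq_uv wu; split=> [|d wE].
  rewrite vE /=; apply/negP => /imageP[d _ def_w].
  by apply: neq_uv; apply: (alt_parent hC vE (d := d)); rewrite -def_w.
have [v' [c' [v'E uc']]] := dtheta_parent hC wE wu.
by move/negP: uv; apply; rewrite -(max_uniq hC v'E vE) v'E uc'; apply: image_f.
Qed.

(** Here [v] acts as a leaf, so the decision parameters for [r] may differ arbitrarily. The
    condition on [v] is void for nodes that do not reach it. *)
Lemma eval_off_max p q w :
  valuation_ge0 p ->
  (forall l : node C, (forall d, gt l <> DTheta D d r) -> leaf_le p q (gt l)) ->
  (connect wire w v -> eval_sum p v <= eval_sum q v) ->
  off_max w -> eval_sum p w <= eval_sum q w.
Proof.
move=> p0 le_pq le_v off_w.
apply: (@eval_sum_mono p q (fun w => off_max w /\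
  (connect wire w v -> eval_sum p v <= eval_sum q v))) => // {off_w le_v}u [off_u le_v].
have [uv|/eqP neq_uv] := eqVneq u v;
  first by left; move: le_v; rewrite uv; apply; apply: connect0.
right; split; first by apply: le_pq; case: off_u.
move=> x xu; split; first exact: off_max_child xu.
by move=> xv; apply/le_v/connect_trans/xv/child_connect.
Qed.

(* Along a live path above a node growing with the parameters of X, a product
   cannot have a second factor growing with them, as the root is linear in
   them: the other factors keep the non-zero values they have under [p0]. *)
Lemma live_strict X p0 p q w :
  valuation_ge0 p ->
  (forall l : node C, (forall d, gt l <> DTheta D d r) -> leaf_le p q (gt l)) ->
  eq_off X p p0 -> eval_sum p v <= eval_sum q v ->
  live p0 w -> connect wire w v -> grows X w -> eval_sum p w < eval_sum q w ->
  eval_sum p (Defs.root C) < eval_sum q (Defs.root C).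
Proof.
move=> p_ge0 le_pq pp0 le_v;
elim=> // u {}w live_u IHu /local_derivP[wu uP] wv [m m0 mP] lt_w.
have uv := connect_trans (child_connect wu) wv.
have neq_uv : u <> v by move=> uv'; move: (child_acyclic wu); rewrite uv' wv.
have off_u : off_max u.
  split=> [|d uE]; last by rewrite uE in wu.
  by apply/negP => /child_acyclic; rewrite uv.
have le_x x : x \in children (gt u) -> eval_sum p x <= eval_sum q x.
  by move=> xu; apply: eval_off_max => //; apply: off_max_child xu.
case: uP => [evE|[s [i [uE wi prod0]]]].
  apply: IHu => //.
    exists m => // b b1; apply: le_trans (mP b b1) _.
    rewrite evE (big_rem w) //= lerDl sumr_ge0 // => x _; exact: eval_scaled_ge0.
  rewrite !evE !(big_rem w wu) /= ltr_leD // ler_big_seq_sum // => x /mem_rem.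
  exact: le_x.
have p0_neq0 j : j != i -> eval_sum p0 (nth w s j) != 0.
  by move: j; apply/prodf_neq0.
have ones_gt0 (j : 'I_(size s)) : j != i -> 0 < eval_sum (scaled X 1) (nth w s j).
  by move/p0_neq0; apply: eval_scaled_gt0.
(* A second growing factor would make [u] grow at least quadratically, against the linear bound on
   live nodes. *)
have free j : j != i -> theta_free X (nth w s j).
  move=> ji; have [//|[m' m'0 m'P]] := theta_free_or_grows X (nth w s j).
  have [B BP] := live_scaled_le X live_u.
  set k := \prod_(l < size s | (l != i) && (l != j)) eval_sum (scaled X 1) (nth w s l).
  have k0 : 0 < k by apply: prodr_gt0 => l /andP[li _]; apply: ones_gt0.
  case: (@quadratic_not_linear (m * m' * k) B) => [|b b1].
    by rewrite !mulr_gt0.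
  apply: le_trans (BP b b1); rewrite (eval_sumE _ u) uE /= (prod_nth w i) wi.
  have b0 : 0 <= b by apply: le_trans b1.
  rewrite (bigD1 j) //= (_ : _ * b = m * b * (m' * b * k)); last first.
    by ring.
  have le1 : k <= \prod_(l < size s | (l != i) && (l != j))
      eval_sum (scaled X b) (nth w s l).
    by apply: ler_prod => l _; rewrite eval_scaled_ge0 //= eval_scaled_mono.
  have k0' := ltW k0; have m0' := ltW m0; have m'0' := ltW m'0.
  by apply: ler_pM; rewrite ?mulr_ge0 ?mP //; apply: ler_pM; rewrite ?mulr_ge0 ?m'P.
apply: IHu => //.
  set k := \prod_(j < size s | j != i) eval_sum (scaled X 1) (nth w s j).
  have k0 : 0 < k by apply: prodr_gt0 => l; apply: ones_gt0.
  exists (m * k) => [|b b1]; first by rewrite mulr_gt0.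
  rewrite mulrAC (eval_sumE _ u) uE /= (prod_nth w i) wi.
  have b0 : 0 <= b by apply: le_trans b1.
  apply: ler_pM; rewrite ?mP ?(ltW k0) ?mulr_ge0 // ?(ltW m0) //.
  by apply: ler_prod => l _; rewrite eval_scaled_ge0 //= eval_scaled_mono.
rewrite (eval_sumE p u) (eval_sumE q u) uE /= !(prod_nth w i) wi.
have rest_gt0 : 0 < \prod_(j < size s | j != i) eval_sum p (nth w s j).
  apply: prodr_gt0 => j ji; rewrite lt_def eval_sum_ge0 // andbT.
  by rewrite (free j ji _ _ pp0) p0_neq0.
apply: (@lt_le_trans _ _
  (eval_sum q w * \prod_(j < size s | j != i) eval_sum p (nth w s j))).
  by rewrite ltr_pM2r.
rewrite ler_wpM2l ?(le_trans (eval_sum_ge0 p_ge0 w)) ?(ltW lt_w) //.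
by apply: ler_prod => j ji; rewrite eval_sum_ge0 //= le_x // uE mem_nth.
Qed.

End MaxNode.

End Circuit.

(** * The Bayesian network *)

Section Network.
Context {I : diagram} {R : realFieldType}.
Implicit Types (X Y : var I) (z : asgn I).

Lemma set_var_in z X (x : dom X) : set_var z x X = x.
Proof. by rewrite ffunE dfwith_in. Qed.

Lemma set_var_out z X (x : dom X) Y : X != Y -> set_var z x Y = z Y.
Proof. by move=> XY; rewrite ffunE dfwith_out. Qed.

Lemma set_varK z X (x : dom X) : set_var (set_var z x) (z X) = z.
Proof.
apply/ffunP => Y; have [<-|XY] := eqVneq X Y; first by rewrite set_var_in.
by rewrite !set_var_out.
Qed.

Lemma restr_eq (A : {set var I}) z z' :
  {in A, forall X, z X = z' X} -> restr A z = restr A z'.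
Proof. by move=> zz'; apply/ffunP => X; rewrite !ffunE zz' // (valP X). Qed.

Lemma restr_set_var (A : {set var I}) z X (x : dom X) :
  X \notin A -> restr A (set_var z x) = restr A z.
Proof.
move=> XA; apply: restr_eq => Y YA; apply: set_var_out.
by apply: contraNneq XA => ->.
Qed.

Lemma not_own_parent X : X \notin pa X.
Proof. by apply/negP => XX; have /negP[] := @pa_acyclic I X X XX; apply: connect0. Qed.

Lemma sum_set_var X (H : asgn I -> R) :
  \sum_z \sum_(x : dom X) H (set_var z x) = #|dom X|%:R * \sum_z H z.
Proof.
rewrite pair_big /=.
(* exchanges x and the value of X in z *)
pose h (zx : asgn I * dom X) := (set_var zx.1 zx.2, zx.1 X).
have hK : involutive h by case=> z x; rewrite /h /= set_varK set_var_in.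
rewrite (reindex_inj (inv_inj hK)) /=.
under eq_bigr => zx _ do rewrite set_varK.
rewrite -(pair_big predT predT (fun z (_ : dom X) => H z)) /= mulr_sumr.
by apply: eq_bigr => z _; rewrite sumr_const mulr_natl.
Qed.

(** * Summing out barren variables *)

Section Barren.
Variables (A : {set var I}) (g : asgn I -> R) (F : var I -> asgn I -> R).
Hypothesis A_closed : forall X Y, X \in pa Y -> Y \in A -> X \in A.
Hypothesis g_local : forall X z (x : dom X), X \notin A -> g (set_var z x) = g z.
Hypothesis F_local : forall X Y z (x : dom X),
  X != Y -> X \notin pa Y -> F Y (set_var z x) = F Y z.
Hypothesis F_sum1 : forall X z, X \notin A -> \sum_(x : dom X) F X (set_var z x) = 1.

(* Eliminating a sink outside A divides by the size of its domain, because the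
   sums range over instantiations of all the variables. *)
Lemma sum_barren (S : {set var I}) : A \subset S ->
  (\prod_(X in S :\: A) #|dom X|%:R) * (\sum_z g z * \prod_(X in S) F X z) =
  \sum_z g z * \prod_(X in A) F X z.
Proof.
have [n] := ubnP #|S|; elim: n S => // n IHn S; rewrite ltnS => le_n AS.
have [SA|/set0Pn[X0 X0S]] := eqVneq (S :\: A) set0.
  rewrite SA big_set0 mul1r; have -> // : S = A.
  by apply/eqP; rewrite eqEsubset AS andbT -setD_eq0 SA.
(* A variable of [S] outside [A] with fewest descendants has no child in [S]: such a child would lie
   outside [A], which is closed under parents, and have fewer. *)
pose X := [arg min_(X < X0 in S :\: A) #|connect (@Defs.arc I) X|]%N.
have [XSA Xmin] : X \in S :\: A /\
    forall Y, Y \in S :\: A ->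
      (#|connect (@Defs.arc I) X| <= #|connect (@Defs.arc I) Y|)%N.
  by rewrite /X; case: arg_minnP.
have [XS XA] : X \in S /\ X \notin A by move: XSA; rewrite inE => /andP[].
have sink Y : Y \in S -> X \notin pa Y.
  move=> YS; apply/negP => XY.
  have YA : Y \notin A by apply: contra XA; apply: A_closed XY.
  have := Xmin Y; rewrite inE YA YS leqNgt => /(_ isT)/negP; apply.
  exact: (acyclic_card_connect (@pa_acyclic I)).
have ASX : A \subset S :\ X.
  apply/subsetP => Y YA; rewrite !inE (subsetP AS) // andbT.
  by apply: contraNneq XA => <-.
have lt_n : (#|S :\ X| < n)%N by move: le_n; rewrite (cardsD1 X) XS.
rewrite -(IHn _ lt_n ASX) (bigD1 X) //= mulrAC -sum_set_var mulrC.
congr (_ * _).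
  by apply: eq_bigl => Y; rewrite !inE; case: (Y \in A); case: (Y == X); case: (Y \in S).
apply: eq_bigr => z _.
have XY Y : Y \in S :\ X -> X != Y by rewrite !inE eq_sym => /andP[].
transitivity (\sum_(x : dom X) F X (set_var z x) * (g z * \prod_(Y in S :\ X) F Y z)).
  apply: eq_bigr => x _; rewrite g_local // (big_setD1 X) //= mulrCA; congr (_ * (_ * _)).
  apply: eq_bigr => Y YS; rewrite F_local ?XY ?sink //.
  by move: YS; rewrite inE => /andP[].
by rewrite -mulr_suml F_sum1 // mul1r.
Qed.

End Barren.

(** * Probabilities under a strategy *)

Section Probability.
Context {K : nat} (P : metaparam I R K).
Variable tau : {ffun 'I_K -> R}.
Hypothesis box_tau : box tau.
Implicit Types (s : strategy I) (e : observation I).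

(** Under a strategy a decision behaves like a chance variable with a deterministic table, so both
    kinds can be summed out alike. *)
Definition factor s (X : var I) z : R :=
  match X with
  | inl Y => theta P tau (z (inl Y)) (restr (pa (inl Y)) z)
  | inr D => (z (inr D) == s D (restr (pa (inr D)) z))%:R
  end.

Lemma joint_factor s z : joint P tau s z = \prod_X factor s X z.
Proof. by rewrite big_sumType. Qed.

Lemma factor_local s X Y z (x : dom X) :
  X != Y -> X \notin pa Y -> factor s Y (set_var z x) = factor s Y z.
Proof.
by case: Y => Y XY XpY; rewrite /factor restr_set_var // set_var_out.
Qed.

Lemma factor_sum1 s X z : \sum_(x : dom X) factor s X (set_var z x) = 1.
Proof.
case: X => [X|D]; rewrite /factor.
  under eq_bigr => x _ do rewrite restr_set_var ?not_own_parent // set_var_in.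
  exact: theta_sum1.
under eq_bigr => x _ do rewrite restr_set_var ?not_own_parent // set_var_in.
by rewrite (bigD1 (s D (restr (pa (inr D)) z))) //= eqxx big1 ?addr0 // => x /negPf->.
Qed.

Lemma joint_ge0 s z : 0 <= joint P tau s z.
Proof.
rewrite /joint mulr_ge0 // prodr_ge0 // => X _; exact: theta_ge0.
Qed.

Lemma prob_ge0 s e : 0 <= prob P tau s e.
Proof. by apply: sumr_ge0 => z _; apply: joint_ge0. Qed.

(** The variables not downstream of any decision form a set closed under parents that contains the
    evidence; once all others are summed out, no factor mentions the strategy. *)
Lemma prob_evidence s s' e :
  is_evidence e -> prob P tau s e = prob P tau s' e.
Proof.
move=> [_ he]; pose A := [set X : var I | [forall D, ~~ connect (@Defs.arc I) (inr D) X]].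
have A_closed X Y : X \in pa Y -> Y \in A -> X \in A.
  rewrite !inE => XY /forallP YA; apply/forallP => D; apply: contra (YA D) => DX.
  exact/connect_trans/connect1/XY.
have decA D : inr D \notin A.
    by rewrite inE; apply/forallPn; exists D; rewrite negbK connect0.
pose g z : R := (agree e z)%:R.
have g_local X z (x : dom X) : X \notin A -> g (set_var z x) = g z.
  move=> XA; rewrite /g /agree; congr (_%:R); congr (nat_of_bool _).
  apply: eq_forallb => Y.
  case eY: (e Y) => [y|//]; rewrite set_var_out //; apply: contraNneq XA => ->.
  by rewrite inE; apply/forallP => D; apply: he; rewrite eY.
have probE s0 : prob P tau s0 e = \sum_z g z * \prod_(X in setT) factor s0 X z.
  rewrite /prob big_mkcond; apply: eq_bigr => z _ /=; rewrite /g.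
  rewrite (eq_bigl predT) => [|X]; last by rewrite inE.
  by rewrite -joint_factor; case: ifP => _; rewrite ?mul1r ?mul0r.
(* If an instantiation exists, no domain is empty and the product of their sizes can be
   cancelled. *)
have [z0 _|noz] := pickP (predT : pred (asgn I)); last first.
  by rewrite /prob !big1 // => z; have := noz z.
have dom0 : \prod_(X in setT :\: A) #|dom X|%:R != 0 :> R.
  apply/prodf_neq0 => X _; rewrite pnatr_eq0 -lt0n.
  by apply/card_gt0P; exists (z0 X).
apply: (mulfI dom0); rewrite !probE.
have barren s0 := @sum_barren A g (factor s0) A_closed g_local
  (@factor_local s0) (fun X z _ => factor_sum1 s0 X z) setT (subsetT A).
rewrite !barren; apply: eq_bigr => z _; congr (_ * _).
by apply: eq_bigr => -[X|D] XA //; have := decA D; rewrite XA.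
Qed.

Lemma prob_with_util1_le s e :
  is_evidence e -> prob P tau s (with_util1 e) <= prob P tau s e.
Proof.
move=> [eU _]; rewrite /prob [leRHS](bigID (agree (with_util1 e))) /=.
rewrite [X in X + _](eq_bigl (agree (with_util1 e))) => [|z].
  by rewrite lerDl sumr_ge0 // => z _; apply: joint_ge0.
rewrite andb_idl // => /forallP ez; apply/forallP => X; have := ez X.
rewrite /with_util1; have [->|UX] := eqVneq X (util I); last by rewrite dfwith_out // eq_sym.
by rewrite eU.
Qed.

End Probability.

(** * Dynamic programming dominates every strategy *)

Section DynamicProgramming.
Context {V : relevance I}.
Variables (p : valuation (I := I) (R := R) (V := V)) (s : strategy I).

Definition follows (D : 'I_(ndec I)) z : bool :=
  z (inr D) == s (restr (pa (inr D)) z).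

Lemma sum_le_dp (ord : seq (var I)) : observation_order ord -> forall z0,
  \sum_z network_term p z * [forall D, follows D z]%:R <= dp p ord z0.
Proof.
case=> ord_uniq ord_all ord_pa z0.
(* Generalization: the variables of [pre] are fixed by [z], those of [l] remain to be eliminated,
   and on the right only the decisions already fixed are tested. *)
suff main l pre z : pre ++ l = ord ->
    \sum_(z' : asgn I | [forall X, (X \in l) || (z' X == z X)])
       network_term p z' * [forall D, follows D z']%:R
    <= dp p l z * [forall D, (inr D \in pre) ==> follows D z]%:R.
  have := main ord [::] z0 erefl.
  have -> : [forall D, ((inr D : var I) \in [::]) ==> follows D z0].
    by apply/forallP.
  rewrite mulr1; congr (_ <= _); apply: eq_bigl => z.
  by apply/forallP => X; rewrite ord_all.
elim: l pre z => [|X l IHl] pre z def_ord /=.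
  rewrite cats0 in def_ord; rewrite (big_pred1 z) => [|z'].
    have -> // : [forall D, (inr D \in pre) ==> follows D z] = [forall D, follows D z].
    by apply: eq_forallb => D; rewrite def_ord ord_all.
  apply/forallP/eqP => [zz'|-> X //]; apply/ffunP => X.
  exact/eqP/zz'.
have Xl : X \notin l.
  by move: ord_uniq; rewrite -def_ord cat_uniq => /and3P[_ _ /=/andP[]].
have Xpre : X \notin pre.
  move: ord_uniq; rewrite -def_ord cat_uniq /= negb_or => /and3P[_ /andP[]]//.
have {}IHl z1 : \sum_(z' : asgn I | [forall X, (X \in l) || (z' X == z1 X)])
       network_term p z' * [forall D, follows D z']%:R
    <= dp p l z1 * [forall D, (inr D \in rcons pre X) ==> follows D z1]%:R.
  by apply: IHl; rewrite cat_rcons.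
(* [X] is observed after [D], hence is no parent of [D]: whether [D] follows [s] is already
   settled. *)
have dec_pre D (x : dom X) : inr D \in pre -> follows D (set_var z x) = follows D z.
  move=> Dpre; have XD : X != inr D by apply: contraNneq Xpre => ->.
  rewrite /follows set_var_out // restr_set_var // ord_pa // -def_ord.
  rewrite !index_cat Dpre (negPf Xpre) /= eqxx addn0 -leqNgt ltnW //.
  by rewrite index_mem.
have split_sum : \sum_(z' : asgn I | [forall Y, (Y \in X :: l) || (z' Y == z Y)])
       network_term p z' * [forall D, follows D z']%:R
    <= \sum_(x : dom X) dp p l (set_var z x) *
         [forall D, (inr D \in rcons pre X) ==> follows D (set_var z x)]%:R.
  rewrite (partition_big (fun z' : asgn I => z' X) predT) //=.
  apply: ler_sum => x _; apply: le_trans (IHl (set_var z x)).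
  rewrite (eq_bigl (fun z' : asgn I =>
    [forall Y, (Y \in l) || (z' Y == set_var z x Y)])) // => z'.
  apply/andP/forallP => [[/forallP zz' /eqP z'X] Y|zz'].
    have [<-|XY] := eqVneq X Y; first by rewrite set_var_in z'X eqxx orbT.
    by have := zz' Y; rewrite inE eq_sym (negPf XY) set_var_out.
  split; last by have := zz' X; rewrite (negPf Xl) set_var_in.
  apply/forallP => Y; have [<-|XY] := eqVneq X Y; first by rewrite mem_head.
  by have := zz' Y; rewrite set_var_out // inE => /orP[->|->]; rewrite ?orbT.
apply: le_trans split_sum _.
case: X Xl Xpre {IHl} dec_pre def_ord => [X|D] Xl Xpre dec_pre def_ord.
  rewrite mulr_suml; apply: ler_sum => x _.
  rewrite (eq_forallb (P2 := fun D => (inr D \in pre) ==> follows D z)) // => D.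
  rewrite mem_rcons inE /=; case: (boolP (_ \in _)) => //= Dpre.
  exact: dec_pre.
set f := [forall D, _ ==> follows D z].
(* Only the alternative prescribed by [s] survives, and the maximum bounds its term. *)
rewrite (eq_bigr (fun d : dom (inr D) => dp p l (set_var z d) *
    (if d == s (restr (pa (inr D)) z) then f%:R else 0))) => [|d _]; last first.
  congr (_ * _).
  have -> : [forall D0, (inr D0 \in rcons pre (inr D)) ==> follows D0 (set_var z d)]
      = (d == s (restr (pa (inr D)) z)) && f.
    have fD : follows D (set_var z d) = (d == s (restr (pa (inr D)) z)).
      by rewrite /follows set_var_in restr_set_var // not_own_parent.
    apply/forallP/andP => [foll|[ds /forallP foll] D'].
      split; first by have := foll D; rewrite mem_rcons mem_head fD.
      apply/forallP => D'; have := foll D'; rewrite mem_rcons inE.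
      by case: (boolP (_ \in pre)) => //= Dpre; rewrite orbT dec_pre.
    rewrite mem_rcons inE; have [[->]|_] := eqVneq; first by rewrite fD.
    by have := foll D'; case: (boolP (_ \in pre)) => //= Dpre; rewrite dec_pre.
  by case: eqP.
rewrite (bigD1 (s (restr (pa (inr D)) z))) //= eqxx big1 ?addr0;
  last by move=> d /negPf->; rewrite mulr0.
apply: ler_wpM2r; first exact: ler0n.
exact: (le_bigmax 0 (fun d : dom (inr D) => dp p l (set_var z d))).
Qed.

End DynamicProgramming.

End Network.

(** * Locally optimal selections *)

Section Selection.
Context {I : diagram} {R : realFieldType} {V : relevance I} {K : nat}.
Variables (P : metaparam I R K) (C : circuit R V) (e : observation I).
Hypothesis hC : is_decision_circuit C.
Implicit Types (tau : {ffun 'I_K -> R}) (sel : selection (V := V)).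
Implicit Types (u v w : node C).

Lemma eval_sum_ext (p q : valuation (I := I) (R := R) (V := V)) :
  (forall v, leaf_le p q (gt v) /\ leaf_le q p (gt v)) ->
  forall v, eval_sum (C := C) p v = eval_sum q v.
Proof.
move=> pq; elim/(@circuit_ind _ _ _ C) => v IHv; rewrite !eval_sumE.
rewrite (eq_gate_eval _ _ (f' := eval_sum q)) => [|w wv]; last first.
  exact: IHv (child_connect wv) (child_neq wv).
by case: (pq v); case: (gt v) => //= *; apply/le_anti/andP.
Qed.

Lemma indicator_ge0 (e' : observation I) (X : var I) (x : dom X) :
  0 <= indicator (R := R) e' x.
Proof. by case: X x => [X|D] x /=; [case: (e' X) => [y|] | ]; rewrite ?ler0n ?ler01. Qed.

Lemma val_init_ge0 tau : box tau -> valuation_ge0 (val_init (V := V) P e tau).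
Proof.
by move=> box_tau; split=> [X x|X x w|D d r] /=;
   [apply: indicator_ge0 | apply: theta_ge0 |].
Qed.

Lemma val_sel_ge0 tau sel : box tau -> valuation_ge0 (val_sel P e tau sel).
Proof.
by move=> box_tau; split=> [X x|X x w|D d r] /=;
   [apply: indicator_ge0 | apply: theta_ge0 |].
Qed.

Lemma prod_nat_forall (T : finType) (b : pred T) :
  \prod_x (b x)%:R = [forall x, b x]%:R :> R.
Proof.
have [/forallP b1|/forallPn[x bx]] := boolP [forall x, b x].
  by apply: big1 => x _; rewrite b1.
by rewrite (bigD1 x) //= (negPf bx) mul0r.
Qed.

Lemma prod_indicator (e' : observation I) (z : asgn I) :
  \prod_(X : var I) indicator e' (z X) = (agree e' z)%:R :> R.
Proof.
rewrite big_sumType /= big1_eq mulr1 /agree -prod_nat_forall.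
by apply: eq_bigr => X _; case: (e' X).
Qed.

Lemma subinst_restr D (z : asgn I) :
  subinst (relpaS V D) (restr (pa (inr D)) z) = restr (relpa V D) z.
Proof. by apply/ffunP => X; rewrite !ffunE. Qed.

Lemma strategy_of_restr sel D (z : asgn I) :
  strategy_of sel (restr (pa (inr D)) z) = sel D (restr (relpa V D) z).
Proof. by rewrite /strategy_of subinst_restr. Qed.

Lemma eval_root_sel tau sel :
  eval_sum (val_sel P e tau sel) (Defs.root C) =
    prob P tau (strategy_of sel) (with_util1 e).
Proof.
rewrite (sum_polynomial hC) /prob [RHS]big_mkcond; apply: eq_bigr => z _.
rewrite /network_term /= prod_indicator /joint.
under [X in (if _ then _ * X else _)]eq_bigr => D _ do rewrite strategy_of_restr.
by case: ifP => _; rewrite ?mul1r ?mul0r.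
Qed.

(** Admissibility absorbs the availability factors, after which the bound by dynamic programming
    applies. *)
Lemma prob_le_eval_max tau s : box tau -> admissible s ->
  prob P tau s (with_util1 e) <= eval_max (val_init P e tau) (Defs.root C).
Proof.
move=> box_tau adm_s; have [z0 _|noz] := pickP (predT : pred (asgn I)); last first.
  rewrite /prob big1 => [|z _]; first exact/eval_max_ge0/val_init_ge0.
  by have := noz z.
have [ord ord_obs /(_ _ (val_init_ge0 box_tau) z0) ->] := max_dp hC.
apply: le_trans (sum_le_dp _ s ord_obs z0); rewrite /prob big_mkcond.
rewrite le_eqVlt; apply/orP; left; apply/eqP; apply: eq_bigr => z _.
rewrite /network_term /= prod_indicator /joint !prod_nat_forall.
case: ifP => _; rewrite ?mul1r ?mul0r // -mulrA; congr (_ * _).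
rewrite -natrM mulnb; congr (_%:R); congr (nat_of_bool _).
apply/idP/andP => [foll|[]//]; split=> //; apply/forallP => D.
by move/forallP/(_ D): foll => /eqP ->; rewrite -subinst_restr ravailE.
Qed.

(* The nodes at which the two sweeps agree: an alternative that is not selected
   keeps its value in the maximizing sweep but is 0 in the summing one. *)
Definition plain w : Prop :=
  (forall v D (r : scen V D) c, gt v = Max D r c -> w \notin children (gt v)) /\
  forall D (d : dom (inr D)) (r : scen V D), gt w <> DTheta D d r.

Lemma plain_root : plain (Defs.root C).
Proof. by split=> [v D r c _|D d r]; [apply: root_not_child | apply: root_not_dtheta]. Qed.

Lemma plain_off_max w v D (r : scen V D) c : gt v = Max D r c -> plain w -> off_max v r w.
Proof. by move=> vE [w1 w2]; split; [apply: w1 vE | move=> d; apply: w2]. Qed.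

Lemma plain_child u w :
  plain u -> (forall D (r : scen V D) c, gt u <> Max D r c) ->
  w \in children (gt u) -> plain w.
Proof.
move=> plain_u not_max wu; split=> [v D r c vE|D d r wE]; last first.
  have [v [c [vE uc]]] := dtheta_parent hC wE wu.
  by have /negP[] := plain_u.1 _ _ _ _ vE; rewrite vE uc; apply: image_f.
rewrite vE; apply/negP => /imageP[d _ wd]; case: (not_max D r c); rewrite -vE.
by congr gt; apply: (alt_parent hC vE (d := d)); rewrite -wd.
Qed.

Lemma Max_inj D (r r' : scen V D) (c c' : dom (inr D) -> node C) :
  Max D r c = Max D r' c' :> gate R V (node C) -> c = c'.
Proof.
by case=> _; apply: (@eq_from_Tagged _ (fun D : 'I_(ndec I) => dom (inr D) -> node C)).
Qed.

(** No child of [c a] is an alternative, since the parent of an alternative is a max node while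
    [c a] is a product. A decision parameter among the children belongs to [v], the only parent of
    [c a], and to [a] by injectivity of [c]. *)
Lemma alternative_child v D (r : scen V D) c a x :
  gt v = Max D r c -> x \in children (gt (c a)) ->
  plain x \/ gt x = DTheta D a r.
Proof.
move=> vE xca.
have not_alt v' D' (r' : scen V D') c' : gt v' = Max D' r' c' -> x \notin children (gt v').
  move=> v'E; rewrite v'E; apply/negP => /imageP[d _ xd].
  have := alt_parent hC v'E (d := d); rewrite -xd => /(_ _ xca) ca.
  by have [s [E _ _]] := max_factor hC vE a; rewrite ca v'E in E.
case E: (gt x) => [b|Y y|Y y i|D' d r'|s|s|D' r' c'];
  try by left; split=> // ? ? ?; rewrite E.
right; have [v' [c' [v'E ca]]] := dtheta_parent hC E xca.
have vv' : v = v' by apply: (alt_parent hC v'E (d := d)); rewrite -ca vE; apply: image_f.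
move: (v'E); rewrite -vv' vE => maxE.
have DD : D = D' by case: maxE.
subst D'; have rr : r = r'.
  by case: maxE => /(@eq_from_Tagged _ (fun D : 'I_(ndec I) => scen V D)).
by rewrite -rr (max_inj hC vE (x1 := a) (x2 := d)) // ca (Max_inj maxE).
Qed.

Lemma eval_sum_chosen (p : valuation (I := I) (R := R) (V := V)) v D (r : scen V D) c a :
  gt v = Max D r c -> (forall d, d != a -> vdth p d r = 0) ->
  eval_sum p v = eval_sum p (c a).
Proof.
move=> vE p0; rewrite eval_sumE vE /= big_image /= (bigD1 a) //= big1 ?addr0 // => d da.
have [s [E _ [l ls lE]]] := max_factor hC vE d; rewrite eval_sumE E /=.
by rewrite (big_rem l ls) /= eval_sumE lE /= p0 ?mul0r.
Qed.

Lemma sel_with_in sel D (r : scen V D) a : sel_with sel r a r = a.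
Proof. by rewrite /sel_with dfwith_in eqxx. Qed.

Lemma sel_with_out sel D (r : scen V D) a D' (r' : scen V D') d' :
  (forall d, DTheta D' d' r' <> DTheta D d r :> gate R V (node C)) ->
  sel_with sel r a r' = sel D' r'.
Proof.
move=> neq; rewrite /sel_with; have [DD|DD] := eqVneq D D'; last by rewrite dfwith_out.
subst D'; rewrite dfwith_in; case: eqP => // rr.
by case: (neq d'); rewrite rr.
Qed.

Lemma sel_with_id sel D (r : scen V D) D' (r' : scen V D') :
  sel_with sel r (sel D r) r' = sel D' r'.
Proof.
rewrite /sel_with; have [DD|DD] := eqVneq D D'; last by rewrite dfwith_out.
by subst D'; rewrite dfwith_in; case: eqP => // ->.
Qed.

Lemma sel_with_leaf tau sel D (r : scen V D) a (g : gate R V (node C)) :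
  (forall d, g <> DTheta D d r) ->
  leaf_le (val_sel P e tau sel) (val_sel P e tau (sel_with sel r a)) g /\
  leaf_le (val_sel P e tau (sel_with sel r a)) (val_sel P e tau sel) g.
Proof.
case: g => //= D' d' r' neq.
by have -> := sel_with_out sel a neq.
Qed.

Lemma eval_sel_with_id tau sel D (r : scen V D) v :
  eval_sum (val_sel P e tau (sel_with sel r (sel D r))) v =
  eval_sum (val_sel P e tau sel) v.
Proof.
apply: eval_sum_ext => w; case: (gt w) => //= D' d' r'.
by rewrite sel_with_id.
Qed.

(** * Agreement of the maximizing and summing sweeps *)

Section Optimal.
Variables (tau : {ffun 'I_K -> R}) (sel : selection (V := V)).
Hypothesis box_tau : box tau.

Let vmax := eval_max (C := C) (val_init P e tau).
Let vsum := eval_sum (C := C) (val_sel P e tau sel).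

(** Both valuations give the decision parameter of [a] the value 1. The other factors are plain and
    strictly below [v], where changing the selection at [v] has no effect. *)
Lemma eval_max_alternative v D (r : scen V D) c a :
  gt v = Max D r c -> a \in ravail r ->
  {in children (gt (c a)), forall x, plain x -> vmax x = vsum x} ->
  vmax (c a) = eval_sum (val_sel P e tau (sel_with sel r a)) v.
Proof.
move=> vE ra IH; rewrite (eval_sum_chosen (a := a) vE) => [|d /negPf da]; last first.
  by rewrite /= sel_with_in da.
have [s [E _ _]] := max_factor hC vE a.
rewrite /vmax eval_maxE eval_sumE E /=; apply: eq_big_seq => x xs.
have xca : x \in children (gt (c a)) by rewrite E.
have [plain_x|xE] := alternative_child vE xca; last first.
  by rewrite eval_maxE eval_sumE xE /= sel_with_in ra eqxx.
rewrite -/(vmax x) IH // /vsum.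
have not_below : ~~ connect (@wire _ _ _ C) x v.
  have cav : c a \in children (gt v) by rewrite vE; apply: image_f.
  apply: contra (child_acyclic cav) => xv.
  exact: connect_trans (child_connect xca) xv.
have off_x := plain_off_max vE plain_x.
apply/le_anti/andP; split; apply: (eval_off_max hC vE) off_x;
  try exact: val_sel_ge0;
  try by move=> xv; rewrite xv in not_below.
  by move=> l /sel_with_leaf lf; case: (lf tau sel a).
by move=> l /sel_with_leaf lf; case: (lf tau sel a).
Qed.

Hypothesis sel_avail : forall D (r : scen V D), @sel D r \in ravail r.
Hypothesis sel_best : forall v D (r : scen V D) c, gt v = Max D r c ->
  {in ravail r, forall a,
     vmax (c a) = eval_sum (val_sel P e tau (sel_with sel r a)) v} ->
  {in ravail r, forall a, vmax (c a) <= vmax (c (@sel D r))}.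

(** The induction supplies the premise of [sel_best] on the values of the alternatives. Local
    optimality can thus come from either sweep: from maximization at the reference values, or from
    the comparisons in [Jint]. *)
Lemma eval_max_plain w : plain w -> vmax w = vsum w.
Proof.
elim/(@circuit_ind _ _ _ C): w => w IHw plain_w.
have same x : (forall D (r : scen V D) c, gt w <> Max D r c) ->
    x \in children (gt w) -> vmax x = vsum x.
  move=> not_max xw; apply: IHw (child_connect xw) (child_neq xw) _.
  exact: plain_child xw.
case E: (gt w) => [b|Y y|Y y i|D d r|s|s|D r c].
- by rewrite /vmax /vsum eval_maxE eval_sumE E.
- by rewrite /vmax /vsum eval_maxE eval_sumE E.
- by rewrite /vmax /vsum eval_maxE eval_sumE E.
- by case: (plain_w.2 _ _ _ E).
- rewrite /vmax /vsum eval_maxE eval_sumE E /=; apply: eq_big_seq => x xs.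
  by apply: same; rewrite E.
- rewrite /vmax /vsum eval_maxE eval_sumE E /=; apply: eq_big_seq => x xs.
  by apply: same; rewrite E.
have alt : {in ravail r, forall a,
    vmax (c a) = eval_sum (val_sel P e tau (sel_with sel r a)) w}.
  move=> a ra; apply: eval_max_alternative => // x xca.
  have caw : c a \in children (gt w) by rewrite E; apply: image_f.
  apply: IHw; first exact: connect_trans (child_connect caw) (child_connect xca).
  by apply: contraTneq (child_acyclic caw) => <-; rewrite negbK child_connect.
rewrite /vsum -(eval_sel_with_id _ _ r) -alt // /vmax eval_maxE E /= -/vmax.
apply/le_anti/andP; split; last exact: (le_bigmax 0 (fun d => vmax (c d))).
apply: bigmax_le => [|a _]; first exact/eval_max_ge0/val_init_ge0.
have [ra|nra] := boolP (a \in ravail r); first exact: (sel_best E alt).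
have [s [caE _ [l ls lE]]] := max_factor hC E a.
rewrite [leLHS]eval_maxE caE /= (big_rem l ls) /= eval_maxE lE /= (negPf nra) mul0r.
exact/eval_max_ge0/val_init_ge0.
Qed.

End Optimal.

End Selection.

(** * Admissible intervals and optimality *)

Lemma box_upd (R : realFieldType) (K : nat) (tau : {ffun 'I_K -> R}) k t :
  box tau -> 0 <= t <= 1 -> box (upd tau k t).
Proof. by move=> box_tau t01 j; rewrite ffunE; case: eqP. Qed.

Theorem theorem3 (R : realFieldType) (I : diagram) (K : nat)
    (P : metaparam I R K) (V : relevance I) (C : circuit R V)
    (hC : is_decision_circuit C)
    (tau0 : {ffun 'I_K -> R}) (htau0 : box tau0)
    (e : observation I) (he : is_evidence e)
    (sel : selection (V := V)) (hsel : selected P C tau0 e sel)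
    (hpos : 0 < prob P tau0 (strategy_of sel) e) :
  forall (k : 'I_K) (t : R), 0 <= t <= 1 ->
    (interval_T P C tau0 e sel k t ->
       optimal P (upd tau0 k t) e (strategy_of sel)) /\
    (~~ interval_W P C tau0 e sel k t ->
       ~ optimal P (upd tau0 k t) e (strategy_of sel)).
Proof.
move=> k t t01; have [sel_avail sel_max] := hsel.
have box_t := box_upd k htau0 t01.
split=> [/and3P[_ /forallP inactiveJ /andP[_ /forallP activeJ]]|].
  split=> [D w|s' adm_s']; first by rewrite -(@ravailE _ V); apply: sel_avail.
  (* The evidence is equally probable under all strategies, so only the numerators are compared. *)
  rewrite /prob_util1 (prob_evidence P box_t s' (strategy_of sel) he).
  rewrite ler_wpM2r ?invr_ge0 ?prob_ge0 // -(eval_root_sel _ _ hC).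
  rewrite -(eval_max_plain hC box_t sel_avail) ?prob_le_eval_max //; last exact: plain_root.
  move=> v D r c vE altE a ra; rewrite !altE //.
  have : Jint P tau0 e sel k v t.
    have := inactiveJ v; have := activeJ v; rewrite /is_max vE /=.
    by case: (active _ _ _ _ v).
  by rewrite /Jint vE => /andP[_ /forallP/(_ a)/implyP/(_ ra)].
rewrite /interval_W t01 /= => /forallPn[v]; rewrite negb_imply => /andP[/andP[_ act_v]].
rewrite /Jint t01 /=; case vE: (gt v) => [b|Y y|Y y i|D d r|s|s|D r c] //.
move=> /forallPn[a]; rewrite negb_imply -ltNge => /andP[ra].
rewrite /hval eval_sel_with_id => lt_v.
have eq_t (s0 : selection (V := V)) :
    eq_off (owner P k) (val_sel P e (upd tau0 k t) s0) (val_sel P e tau0 s0).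
  by split=> // Y y w Yk /=; apply: theta_other => //; rewrite eq_sym.
(* If [v] is free of the owner of [k], the comparison at [t] is the one at the reference values,
   where the selected alternative was already best. *)
have [free_v|grow_v] := theta_free_or_grows hC (owner P k) v.
  move: lt_v; rewrite !(free_v _ _ (eq_t _)) ltNge => /negP[].
  have same (w : node C) : plain w ->
      eval_max (val_init P e tau0) w = eval_sum (val_sel P e tau0 sel) w.
    apply: (eval_max_plain hC htau0 sel_avail).
    by move=> v' D' r' c' v'E _ a' _; apply: sel_max v'E _.
  have alt d : d \in ravail r -> eval_max (val_init P e tau0) (c d) =
      eval_sum (val_sel P e tau0 (sel_with sel r d)) v.
    by move=> rd; apply: (eval_max_alternative hC htau0 vE rd) => x _; apply: same.
  by rewrite -(eval_sel_with_id _ _ tau0 sel r v) -!alt //; apply: sel_max vE _.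
case=> _ /(_ (strategy_of (sel_with sel r a))) opt.
have lt_root : prob P (upd tau0 k t) (strategy_of sel) (with_util1 e) <
    prob P (upd tau0 k t) (strategy_of (sel_with sel r a)) (with_util1 e).
  rewrite -!(eval_root_sel _ _ hC).
  have le_leaf l : (forall d, gt l <> DTheta D d r) ->
      leaf_le (val_sel P e (upd tau0 k t) sel)
        (val_sel P e (upd tau0 k t) (sel_with sel r a)) (gt (c := C) l).
    by case/(sel_with_leaf P e (upd tau0 k t) sel a).
  (* Activity at the reference values gives a live path ending at [v], where the strict improvement
     starts. *)
  exact: (live_strict hC vE (val_sel_ge0 P e sel box_t) le_leaf (eq_t sel) (ltW lt_v)
    (deriv_live act_v) (connect0 _ _) grow_v lt_v).
have prob_e :=
  prob_evidence P box_t (strategy_of (sel_with sel r a)) (strategy_of sel) he.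
(* At [t], P(e) is at least the probability of e and U = 1 under the competing strategy, which
   strictly exceeds a non-negative number. *)
have pos_e : 0 < prob P (upd tau0 k t) (strategy_of sel) e.
  rewrite -prob_e; apply: lt_le_trans (prob_with_util1_le P box_t _ he).
  exact: le_lt_trans (prob_ge0 P box_t _ _) lt_root.
have adm : admissible (strategy_of (sel_with sel r a)).
  move=> D' w; rewrite -(@ravailE _ V) /strategy_of /sel_with.
  have [DD|DD] := eqVneq D D'; last by rewrite dfwith_out.
  by subst D'; rewrite dfwith_in; case: eqP => // ->.
have := opt adm; rewrite /prob_util1 prob_e ler_pM2r ?invr_gt0 //.
by rewrite leNgt lt_root.
Qed.
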